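(* Let $\tilde L_n^{(\tilde r,\tilde s)}(\alpha,x,y,z,a)$ be the generalized $q$-polynomials defined in the context. (i) For $|xt|<1$ and $\tilde r,\tilde s\in\mathbb{Z}^\ast$, we have $$\sum_{n=0}^\infty\tilde L_n^{(\tilde r,\tilde s)}(\alpha,x,y,z,a)\frac{t^n}{(q;q)_n}=\frac{(yt;q)_\infty}{(xt;q)_\infty}\sum_{k=0}^\infty\frac{(-q^{-\alpha},a;q)_k}{(q^2;q^2)_k}\,q^{k\alpha+\tilde r\binom k2-\tilde s\binom{k+1}2}(zt)^k.$$ (ii) For $\tilde r=\tilde s=0$ in the identity of (i) and $\max\{|zt|,|xt|\}<1$, we recover the Cauchy polynomials $p_n(x,y)$ as follows: $$\sum_{n=0}^\infty\frac{p_n(x,y)\,t^n}{(q;q)_n}\sum_{k=0}^n\begin{bmatrix} n \\ k \end{bmatrix}_q\begin{bmatrix} \alpha \\ k \end{bmatrix}_{-q}\frac{(-1)^kq^{k(k-n)}(a;q)_k}{p_k(y,xq^{1-n})}z^k=\frac{(yt;q)_\infty}{(xt;q)_\infty}\;{}_2\Phi_1\left[\begin{array}{c} -q^{-\alpha},a \\ -q \end{array};q;ztq^{\alpha}\right].$$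
   Context: Throughout, $q$ is a fixed nonzero real or complex number with $|q|<1$, and $\alpha\in\mathbb{C}$. $\mathbb{Z}^\ast$ denotes the nonzero integers. Notation: $(a;q)_0=1$, $(a;q)_n=\prod_{k=0}^{n-1}(1-aq^k)$, $(a;q)_\infty=\prod_{k=0}^\infty(1-aq^k)$, $(a_1,\ldots,a_r;q)_n=(a_1;q)_n\cdots(a_r;q)_n$; similarly with base $q^2$. $q$-binomial coefficients: for $\alpha\in\mathbb{C}$ and integers $k\ge 0$, $$\begin{bmatrix} \alpha \\ k \end{bmatrix}_q=\frac{(q^{-\alpha};q)_k}{(q;q)_k}(-1)^kq^{\alpha k-\binom k2},\qquad \begin{bmatrix} \alpha \\ k \end{bmatrix}_{-q}=\frac{(-q^{-\alpha};q)_k}{(-q;q)_k}q^{\alpha k-\binom k2}.$$ Cauchy polynomials: $p_n(x,y)=(x-y)(x-qy)\cdots(x-q^{n-1}y)=(y/x;q)_n\,x^n$, $p_0=1$. Generalized $q$-polynomials: $$\tilde L_n^{(\tilde r,\tilde s)}(\alpha,x,y,z,a)=\sum_{k=0}^n\begin{bmatrix} n \\ k \end{bmatrix}_q\begin{bmatrix} \alpha \\ k \end{bmatrix}_{-q}q^{\tilde r\binom k2-\tilde s\binom{k+1}2+\binom k2}(a;q)_k\,p_{n-k}(x,y)\,z^k.$$ Basic hypergeometric series: ${}_2\Phi_1\left[\begin{array}{c} a_1,a_2 \\ {b_1} \end{array};q;w\right]=\sum_{n=0}^\infty\frac{(a_1,a_2;q)_n}{(b_1;q)_n}\frac{w^n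}{(q;q)_n}$.
   Formalization: The right-hand series can diverge in the stated ranges (e.g. r<s, or |ztq^α|≥1), so its convergence is assumed, except when s<r in (i) or |ztq^α|<1 in (ii), where it is proved; in (ii) the denominators p_k(y,xq^{1-n}), k≤n, are assumed nonzero. *)

(* Defs.v *)
(* Complex numbers are R[i] for R : realType (MathComp); the limits are those of
   MathComp-Analysis on K^o, which carries the topology of the norm of K. *)
From HB Require Import structures.
From mathcomp Require Import all_boot all_order all_algebra.
From mathcomp Require Import all_classical all_reals all_analysis.
From mathcomp Require Import complex.

Set Implicit Arguments.
Unset Strict Implicit.
Unset Printing Implicit Defensive.

Import Order.TTheory GRing.Theory Num.Theory numFieldNormedType.Exports.

Local Open Scope classical_set_scope.
Local Open Scope ring_scope.
Local Open Scope complex_scope.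

Definition qpoch (K : fieldType) (a q : K) (n : nat) : K :=
  \prod_(k < n) (1 - a * q ^+ k).

(* The limit exists whenever `|q| < 1. *)
Definition qpoch_inf (K : numFieldType) (a q : K) : K :=
  limn (fun n => qpoch a q n : K^o).

(* Product form of (y/x; q)_n x^n, which also makes sense for x = 0. *)
Definition cauchy_poly (K : fieldType) (q : K) (n : nat) (x y : K) : K :=
  \prod_(k < n) (x - q ^+ k * y).

Definition phi21_term (K : fieldType) (a1 a2 b1 q w : K) (n : nat) : K :=
  qpoch a1 q n * qpoch a2 q n / qpoch b1 q n * (w ^+ n / qpoch q q n).

Definition phi21 (K : numFieldType) (a1 a2 b1 q w : K) : K :=
  limn (series (phi21_term a1 a2 b1 q w : nat -> K^o)).

Section ComplexPowers.
Variable R : realType.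
Implicit Types (q lam alpha x y z a : R[i]).

Definition cexp z : R[i] :=
  (expR (complex.Re z) * cos (complex.Im z))
    +i* (expR (complex.Re z) * sin (complex.Im z)).

(* The power q^b for the determination lam of log q, i.e. cexp lam = q.
   Below, q and lam are always meant to be related in this way. *)
Definition cpow lam (b : R[i]) : R[i] := cexp (b * lam).

Definition qbinom q lam alpha (k : nat) : R[i] :=
  qpoch (cpow lam (- alpha)) q k / qpoch q q k * (-1) ^+ k
    * cpow lam (alpha * k%:R - 'C(k, 2)%:R).

(* The "base -q" coefficient.  It is not qbinom at -q: only the numerator
   parameter and the parameter of the denominator change sign, while the
   q-shifted factorials keep the base q. *)
Definition qbinom_neg q lam alpha (k : nat) : R[i] :=
  qpoch (- cpow lam (- alpha)) q k / qpoch (- q) q k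
    * cpow lam (alpha * k%:R - 'C(k, 2)%:R).

Definition Ltilde q lam (r s : int) (n : nat) alpha x y z a : R[i] :=
  \sum_(k < n.+1)
     qbinom q lam n%:R k * qbinom_neg q lam alpha k
     * q ^ (r * 'C(k, 2)%:Z - s * 'C(k.+1, 2)%:Z + 'C(k, 2)%:Z)
     * qpoch a q k * cauchy_poly q (n - k) x y * z ^+ k.

End ComplexPowers.

(* Main.v *)
(** The coefficient of t^n on the left is the n-th term of the Cauchy product of
    the series on the right with [sum_m p_m(xt, yt) / (q; q)_m].  The latter
    converges absolutely for |xt| < 1, so by Mertens' theorem plain convergence
    of the other series is enough.  Its sum F(x, y) (with t absorbed in x and y)
    satisfies (1 - x) F(x, y) = (1 - y) F(qx, qy), hence
    (x; q)_N F(x, y) = (y; q)_N F(q^N x, q^N y), where F(q^N x, q^N y) -> 1.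
    Taking x = 0 shows that (y; q)_oo exists and taking y = 0 that (x; q)_oo is
    nonzero for |x| < 1, which gives the q-binomial theorem
    F(x, y) = (y; q)_oo / (x; q)_oo. *)
Require Import Defs.
From HB Require Import structures.
From mathcomp Require Import all_boot all_order all_algebra.
From mathcomp Require Import all_classical all_reals all_analysis.
From mathcomp Require Import complex.
From mathcomp Require Import ring lra zify.

Import Order.TTheory GRing.Theory Num.Theory numFieldNormedType.Exports.
Import ComplexField.Normc.

Local Open Scope classical_set_scope.
Local Open Scope ring_scope.
Local Open Scope complex_scope.

(** * Complex limits, absolute convergence and Cauchy products *)

Section ComplexSequences.
Context {R : realType}.
Implicit Types (u v : nat -> R[i]).

Lemma normcE_norm (z : R[i]) : `|z| = (normc z)%:C.
Proof. by case: z. Qed.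

Lemma normc_ge0 (z : R[i]) : 0 <= normc z.
Proof. by rewrite -ler0c -normcE_norm. Qed.

(** Reduces complex limits to real ones, where squeezing and geometric bounds are available. *)
Lemma cvgc_normP u (l : R[i]) :
  (u : nat -> R[i]^o) @ \oo --> (l : R[i]^o) <->
  (fun n => normc (u n - l)) @ \oo --> (0 : R).
Proof.
split=> [/cvgrPdist_lt ul|/cvgrPdist_lt ul].
  apply/cvgrPdist_lt => e e0.
  have e0' : 0 < e%:C by rewrite ltcR.
  near=> n.
  rewrite sub0r normrN ger0_norm ?normc_ge0// -ltcR -normcE_norm distrC.
  by near: n; exact: ul.
apply/cvgrPdist_lt => e e0.
(* A positive element of [R[i]] is real, so its real part can serve as the tolerance. *)
have eE : e = (complex.Re e)%:C by rewrite RRe_real// gtr0_real.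
have e0' : 0 < complex.Re e by rewrite -ltcR -eE.
near=> n.
rewrite distrC normcE_norm eE ltcR.
rewrite -[normc _]ger0_norm ?normc_ge0// -normrN -sub0r.
by near: n; exact: ul.
Unshelve. all: by end_near. Qed.

Lemma cvgc_ReIm u (a b : R) :
  (fun n => complex.Re (u n)) @ \oo --> a ->
  (fun n => complex.Im (u n)) @ \oo --> b ->
  (u : nat -> R[i]^o) @ \oo --> (a +i* b : R[i]^o).
Proof.
move=> ua ub; apply/cvgc_normP.
apply: (@squeeze_cvgr _ _ _ _ (fun=> 0)
  (fun n => `|complex.Re (u n) - a| + `|complex.Im (u n) - b|)).
- near=> n; rewrite normc_ge0/=.
  case: (u n) => c d /=.
  set r := c - a; set s := d - b.
  have h : 0 <= `|r| + `|s| by rewrite addr_ge0.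
  rewrite -[leRHS](ger0_norm h) -sqrtr_sqr ler_sqrt ?sqr_ge0//.
  rewrite -(real_normK (num_real r)) -(real_normK (num_real s)) sqrrD.
  by rewrite addrAC lerDl mulrn_wge0// mulr_ge0.
- exact: cvg_cst.
- rewrite -[X in _ --> X]addr0 -[X in _ --> X + _](normr0 R).
  rewrite -[X in _ --> _ + X](normr0 R).
  apply: cvgD; apply: cvg_norm.
    by rewrite -(subrr a); apply: cvgB => //; exact: cvg_cst.
  by rewrite -(subrr b); apply: cvgB => //; exact: cvg_cst.
Unshelve. all: by end_near. Qed.

Definition abs_summable u := cvgn (series (fun n => normc (u n))).

Lemma series_Re u n : complex.Re (series u n) = series (fun k => complex.Re (u k)) n.
Proof. by rewrite /series/= raddf_sum. Qed.

Lemma series_Im u n : complex.Im (series u n) = series (fun k => complex.Im (u k)) n.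
Proof. by rewrite /series/= raddf_sum. Qed.

Lemma abs_summable_cvg u : abs_summable u -> cvgn (series (u : nat -> R[i]^o)).
Proof.
move=> us.
have H (p : R[i] -> R) : (forall z, `|p z| <= normc z) ->
    cvgn (series (fun k => p (u k))).
  move=> pn; apply: normed_cvg; apply: (series_le_cvg _ _ _ us) => n /=.
  - exact: normr_ge0.
  - exact: normc_ge0.
  - exact: pn.
have /cvg_ex[a Ha] : cvgn (series (fun k => complex.Re (u k))).
  by apply: H => z; rewrite -lecR -normcE_norm normc_ge_Re.
have /cvg_ex[b Hb] : cvgn (series (fun k => complex.Im (u k))).
  apply: H => z; rewrite -lecR -normcE_norm.
  (* The bound on the imaginary part is the one on the real part of [z * 'i], which is minus the
     imaginary part of [z]. *)
  have := normc_ge_Re (z * 'i).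
  rewrite ReiNIm normrN normrM [X in _ * X]normcE_norm /=.
  by rewrite expr0n expr1n add0r sqrtr1 mulr1.
apply/cvg_ex; exists (a +i* b : R[i]^o); apply: cvgc_ReIm.
  by under eq_fun do rewrite series_Re.
by under eq_fun do rewrite series_Im.
Qed.

(* Stated without quotients, so that terminating series are covered too. *)
Lemma ratio_test u v (l : R[i]) :
  (forall n, u n.+1 = u n * v n) ->
  (v : nat -> R[i]^o) @ \oo --> (l : R[i]^o) -> `|l| < 1 -> abs_summable u.
Proof.
move=> uS vl l1.
have l1' : normc l < 1 by rewrite -ltcR -normcE_norm.
(* The midpoint of [normc l] and 1: it eventually dominates the ratios, and it stays positive even
   when [l] is 0. *)
pose rho := (normc l + 1) / 2.
have rho1 : rho < 1 by rewrite /rho; lra.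
have lrho : 0 < rho - normc l by rewrite /rho; lra.
have rho0 : 0 <= rho by have := normc_ge0 l; rewrite /rho; lra.
have [N _ HN] : \forall n \near \oo, normc (v n) <= rho.
  have /cvgc_normP/cvgrPdist_lt/(_ _ lrho) := vl.
  apply: filterS => n; rewrite sub0r normrN ger0_norm ?normc_ge0// => h.
  have := le_normcD (v n - l) l; rewrite subrK; lra.
have rho_gt0 : 0 < rho by have := normc_ge0 l; rewrite /rho; lra.
(* Each summand is at most [M], so the geometric bound holds up to rank [N]; from there on the ratio
   bound propagates it. *)
pose M := \sum_(k < N.+1) normc (u k) / rho ^+ k.
have M0 : 0 <= M.
  by apply: sumr_ge0 => k _; rewrite divr_ge0 ?normc_ge0 ?exprn_ge0.
have uM n : normc (u n) <= geometric M rho n.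
  elim: n => [|n IH] /=.
    rewrite expr0 mulr1 /M big_ord_recl/= expr0 divr1 lerDl.
    by apply: sumr_ge0 => k _; rewrite divr_ge0 ?normc_ge0 ?exprn_ge0.
  have [nN|Nn] := leqP n.+1 N.
    rewrite -ler_pdivrMr ?exprn_gt0// /M (bigD1 (Ordinal (nN : (n.+1 < N.+1)%N)))//=.
    rewrite lerDl.
    by apply: sumr_ge0 => k _; rewrite divr_ge0 ?normc_ge0 ?exprn_ge0.
  rewrite uS normcM exprSr mulrA ler_pM ?normc_ge0//.
  by apply: HN.
apply: (series_le_cvg _ _ uM) => [n|n|].
- exact: normc_ge0.
- by rewrite /= mulr_ge0 ?exprn_ge0.
by apply: is_cvg_geometric_series; rewrite ger0_norm.
Qed.

(** Controls the error term in [mertens]: [c] will be the moduli of the absolutely summable factor,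
    [d] the distance of the other partial sums to their limit. *)
Lemma conv_cvg0 (c d : nat -> R) : (forall n, 0 <= c n) -> (forall n, 0 <= d n) ->
  cvgn (series c) -> d @ \oo --> 0 ->
  (fun n => \sum_(m < n.+1) c m * d (n - m)%N) @ \oo --> 0.
Proof.
move=> c0 d0 cs dc.
have [D D0 HD] : exists2 D, 0 < D & forall n, d n <= D.
  have /cvg_seq_bounded/pinfty_ex_gt0[D D0 HD] := cvgP _ dc.
  exists D => // n; apply: le_trans (HD n I); exact: ler_norm.
set S := limn (series c).
have nd : nondecreasing_seq (series c).
  by apply/nondecreasing_seqP => n; rewrite /series/= big_nat_recr//= lerDl.
have cS n : series c n <= S by exact: nondecreasing_cvgn_le.
have S0 : 0 <= S by apply: le_trans (cS 0%N); rewrite /series/= big_geq.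
have SD : 0 < S + D by rewrite ltr_wpDl.
apply/cvgrPdist_le => e e0.
(* Chosen so that [e = S * e' + e' * D]; [D] was taken positive so that the denominator is nonzero
   even if [S] vanishes. *)
pose e' := e / (S + D).
have e'0 : 0 < e' by rewrite divr_gt0.
have [N1 _ H1] : \forall n \near \oo, d n <= e'.
  have /cvgrPdist_le/(_ _ e'0) := dc.
  apply: filterS => n; rewrite sub0r normrN; apply: le_trans; exact: ler_norm.
have [N2 _ H2] : \forall n \near \oo, S - series c n <= e'.
  have /cvgrPdist_le/(_ _ e'0) : series c @ \oo --> S by exact: cs.
  apply: filterS => n; apply: le_trans; exact: ler_norm.
pose N := maxn N1 N2.
exists (N + N)%N => // n /= Nn.
rewrite sub0r normrN ger0_norm; last by apply: sumr_ge0 => i _; rewrite mulr_ge0.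
have -> : e = S * e' + e' * D by rewrite -(mulrC D) -mulrDl mulrC divfK// gt_eqF.
(* Terms with [m < N] have [n - m >= N], where [d] is small; the others lie in
   the tail of [c]. *)
apply: (@le_trans _ _ (\sum_(m < n.+1) (c m * e' + (if (N <= m)%N then c m else 0) * D))).
  apply: ler_sum => m _.
  case: leqP => [Nm|mN].
    apply: ler_wpDl; first by apply: mulr_ge0 => //; exact: ltW.
    exact: ler_wpM2l.
  rewrite mul0r addr0; apply: ler_wpM2l => //; apply: H1 => /=.
  rewrite /N in Nn mN *; lia.
rewrite big_split/= -!mulr_suml lerD//.
  apply: ler_wpM2r; first exact: ltW.
  by have := cS n.+1; rewrite /series/= big_mkord.
apply: ler_wpM2r; first exact: ltW.
apply: le_trans (H2 N _); last by rewrite /= leq_maxr.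
rewrite -(@big_mkord _ _ _ _ xpredT (fun m => if (N <= m)%N then c m else 0)).
rewrite (@big_cat_nat _ _ _ N)//=; last by lia.
rewrite big_nat_cond big1 ?add0r; last first.
  by move=> i; rewrite andbT => /andP[_ iN]; rewrite leqNgt iN.
have := cS n.+1; rewrite /series/= (@big_cat_nat _ _ _ N)//=; last by lia.
move=> h; rewrite lerBrDl; apply: le_trans h; rewrite lerD2l.
by rewrite le_eqVlt; apply/orP; left; apply/eqP; apply: eq_big_nat => i /andP[-> _].
Qed.

(** Interchange of summations: [c m] is multiplied by every [b j] with m + j < n, that is, by the
    first n - m terms of [b]. *)
Lemma series_conv (b c : nat -> R[i]) n :
  series (fun n => \sum_(m < n.+1) c m * b (n - m)%N) n
  = \sum_(m < n) c m * series b (n - m)%N.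
Proof.
elim: n => [|n IH]; first by rewrite /series/= big_geq// big_ord0.
rewrite [LHS]/series/= big_nat_recr//=; move: IH; rewrite {1}/series/= => ->.
rewrite big_ord_recr/= subnn [RHS]big_ord_recr/= addrA -big_split/=.
rewrite subSnn /series/= big_nat1; congr (_ + _).
apply: eq_bigr => i _.
by rewrite subSn ?big_nat_recr//= ?mulrDr// ltnW.
Qed.

(** By [series_conv] the partial sums equal [series c n * B] plus the sum of the
    [c m * (series b (n - m) - B)], and the latter tends to 0 by [conv_cvg0]. *)
Lemma mertens (b c : nat -> R[i]) (B : R[i]) :
  abs_summable c -> series (b : nat -> R[i]^o) @ \oo --> (B : R[i]^o) ->
  series ((fun n => \sum_(k < n.+1) b k * c (n - k)%N) : nat -> R[i]^o) @ \oo
  --> (limn (series (c : nat -> R[i]^o)) * B : R[i]^o).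
Proof.
move=> cs bB.
have cA := abs_summable_cvg _ cs.
have -> : (fun n => \sum_(k < n.+1) b k * c (n - k)%N) =
    (fun n => \sum_(m < n.+1) c m * b (n - m)%N).
  apply/funext => n; rewrite (reindex_inj rev_ord_inj); apply: eq_bigr => k _.
  by rewrite mulrC /= subSS subKn// -ltnS.
rewrite -[X in _ --> X]addr0.
have -> : series (fun n => \sum_(m < n.+1) c m * b (n - m)%N) =
   (fun n => series c n * B + \sum_(m < n) c m * (series b (n - m)%N - B)).
  apply/funext => n; rewrite series_conv /series/= big_mkord mulr_suml -big_split/=.
  by apply: eq_bigr => i _; rewrite mulrBr addrC subrK.
apply: (@cvgD _ R[i]^o).
  apply: (@cvgM R[i]); [exact: cA|exact: cvg_cst].
(* The shift of [n] by one gives a sum over [m < n.+1], as in [conv_cvg0]; this is why [d] involves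
   [series b n.+1]. *)
rewrite -(cvg_shiftS (fun n => \sum_(m < n) c m * (series b (n - m)%N - B) : R[i]^o)).
apply/cvgc_normP.
pose d n := normc (series b n.+1 - B).
apply: (@squeeze_cvgr _ _ _ _ (fun=> 0)
   (fun n => \sum_(m < n.+1) normc (c m) * d (n - m)%N)).
- near=> n; rewrite normc_ge0/= subr0 -lecR -normcE_norm.
  rewrite rmorph_sum/=; apply: le_trans (ler_norm_sum _ _ _) _.
  apply: ler_sum => i _.
  by rewrite rmorphM/= normrM /d !normcE_norm subSn// -ltnS.
- exact: cvg_cst.
apply: (conv_cvg0 _ _ _ _ cs) => [n|n|]; [exact: normc_ge0|exact: normc_ge0|].
have /cvgc_normP dB := bB; move: dB.
by rewrite -(cvg_shiftS (fun n => normc (series b n - B))).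
Unshelve. all: by end_near. Qed.

End ComplexSequences.

(** * Elementary properties of q-shifted factorials and Cauchy polynomials *)

Lemma qpoch0 (K : fieldType) (a q : K) : qpoch a q 0 = 1.
Proof. by rewrite /qpoch big_ord0. Qed.

Lemma qpochS (K : fieldType) (a q : K) n :
  qpoch a q n.+1 = qpoch a q n * (1 - a * q ^+ n).
Proof. by rewrite /qpoch big_ord_recr. Qed.

Lemma qpoch0l (K : fieldType) (q : K) n : qpoch 0 q n = 1.
Proof. by rewrite /qpoch big1// => i _; rewrite mul0r subr0. Qed.

Lemma cauchy_poly0 (K : fieldType) (q x y : K) : cauchy_poly q 0 x y = 1.
Proof. by rewrite /cauchy_poly big_ord0. Qed.

Lemma cauchy_polyS (K : fieldType) (q x y : K) n :
  cauchy_poly q n.+1 x y = cauchy_poly q n x y * (x - q ^+ n * y).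
Proof. by rewrite /cauchy_poly big_ord_recr. Qed.

Lemma cauchy_poly_scale (K : fieldType) (q x y t : K) n :
  cauchy_poly q n (x * t) (y * t) = cauchy_poly q n x y * t ^+ n.
Proof.
elim: n => [|n IH]; first by rewrite !cauchy_poly0 mulr1.
by rewrite !cauchy_polyS IH exprSr mulrA -mulrBl mulrACA.
Qed.

Lemma one_sub_neq0 (K : numFieldType) (a : K) : `|a| < 1 -> 1 - a != 0.
Proof.
by move=> a1; rewrite subr_eq0; apply: contraTneq a1 => <-; rewrite normr1 ltxx.
Qed.

Lemma qpoch_neq0 (K : numFieldType) (a q : K) n :
  `|a| < 1 -> `|q| < 1 -> qpoch a q n != 0.
Proof.
move=> a1 q1; apply/prodf_neq0 => i _; apply: one_sub_neq0.
rewrite normrM normrX (le_lt_trans _ a1)// ler_piMr//.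
by rewrite exprn_ile1// ltW.
Qed.

(** * The q-binomial theorem for Cauchy polynomials *)

Section QBinomialTheorem.
Context {R : realType}.
Variable q : R[i].
Hypothesis q_lt1 : `|q| < 1.

Let qq_neq0 n : qpoch q q n != 0.
Proof. exact: qpoch_neq0. Qed.

Let q_neq1 n : 1 - q ^+ n.+1 != 0.
Proof. by apply: one_sub_neq0; rewrite normrX exprn_ilt1. Qed.

Lemma cvg_expc0 (p : R[i]) : `|p| < 1 ->
  ((fun n => p ^+ n) : nat -> R[i]^o) @ \oo --> (0 : R[i]^o).
Proof.
move=> p1; apply/cvgc_normP.
have -> : (fun n => normc (p ^+ n - 0)) = geometric 1 (normc p).
  apply/funext => n; rewrite subr0 /= mul1r.
  by elim: n => [|n IH]; rewrite ?normc1// !exprS normcM IH.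
by apply: cvg_geometric; rewrite ger0_norm ?normc_ge0// -ltcR -normcE_norm.
Qed.

Lemma cvg_cmul_expc (a p : R[i]) : `|p| < 1 ->
  ((fun n => a * p ^+ n) : nat -> R[i]^o) @ \oo --> (0 : R[i]^o).
Proof.
move=> p1; rewrite -[X in _ --> X](mulr0 a).
by apply: (@cvgM R[i]); [exact: cvg_cst|exact: cvg_expc0].
Qed.

Lemma cvg_one_sub_cmul_expc (a p : R[i]) : `|p| < 1 ->
  ((fun n => 1 - a * p ^+ n) : nat -> R[i]^o) @ \oo --> (1 : R[i]^o).
Proof.
move=> p1; rewrite -[X in _ --> X]subr0.
by apply: (@cvgB _ R[i]^o); [exact: cvg_cst|exact: cvg_cmul_expc].
Qed.

(** For nonzero [x] this is the n-th term of the q-binomial series with parameter y/x and argument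
    x; the product form also admits x = 0, which is used to define infinite products. *)
Definition cauchy_term (x y : R[i]) n : R[i] := cauchy_poly q n x y / qpoch q q n.

Lemma cauchy_termS x y n :
  cauchy_term x y n.+1 * (1 - q ^+ n.+1) = cauchy_term x y n * (x - q ^+ n * y).
Proof.
rewrite /cauchy_term cauchy_polyS qpochS -exprS.
by field; rewrite qq_neq0 q_neq1.
Qed.

Lemma cauchy_term_scale x y p n :
  cauchy_term (x * p) (y * p) n = cauchy_term x y n * p ^+ n.
Proof. by rewrite /cauchy_term cauchy_poly_scale mulrAC. Qed.

(** The ratio of consecutive terms, (x - y q^n) / (1 - q^(n+1)), tends to [x]. *)
Lemma cauchy_term_summable x y : `|x| < 1 -> abs_summable (cauchy_term x y).
Proof.
move=> x1.
apply: (@ratio_test _ _ (fun n => (x - y * q ^+ n) / (1 - q * q ^+ n)) (x / 1)).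
- move=> n; rewrite -exprS mulrA (mulrC y) -cauchy_termS mulfK//.
- apply: (@cvgM R[i]).
    rewrite -[X in _ --> X]subr0.
    by apply: (@cvgB _ R[i]^o); [exact: cvg_cst|exact: cvg_cmul_expc].
  by apply: (@cvgV R[i]); [exact: oner_neq0|exact: cvg_one_sub_cmul_expc].
- by rewrite divr1.
Qed.

Definition cauchy_sum x y : R[i] := limn (series (cauchy_term x y : nat -> R[i]^o)).

Lemma cvg_cauchy_sum x y : `|x| < 1 ->
  series (cauchy_term x y : nat -> R[i]^o) @ \oo --> (cauchy_sum x y : R[i]^o).
Proof. by move=> x1; apply: abs_summable_cvg; exact: cauchy_term_summable. Qed.

Lemma norm_mul_expq x n : `|x| < 1 -> `|x * q ^+ n| < 1.
Proof.
move=> x1; rewrite normrM normrX (le_lt_trans _ x1)// ler_piMr//.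
by rewrite exprn_ile1// ltW.
Qed.

(** With c_n the terms, F(x, y) - F(xq, yq) is the sum of c_n (1 - q^n); the recurrence turns it
    into the sum of c_n (x - q^n y), which is x F(x, y) - y F(xq, yq). *)
Lemma cauchy_sum_qshift x y : `|x| < 1 ->
  (1 - x) * cauchy_sum x y = (1 - y) * cauchy_sum (x * q) (y * q).
Proof.
move=> x1.
have F := cvg_cauchy_sum _ y x1.
have G : series (cauchy_term (x * q) (y * q) : nat -> R[i]^o) @ \oo -->
    (cauchy_sum (x * q) (y * q) : R[i]^o).
  by apply: cvg_cauchy_sum; rewrite -[q]expr1 norm_mul_expq.
(* Both terms at 0 equal 1 and cancel, hence [n.+1] terms on the left against [n] on the right. *)
have H n : series (cauchy_term x y) n.+1 - series (cauchy_term (x * q) (y * q)) n.+1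
   = x * series (cauchy_term x y) n - y * series (cauchy_term (x * q) (y * q)) n.
  rewrite /series/= !big_mkord !mulr_sumr -!sumrB big_ord_recl/=.
  rewrite cauchy_term_scale expr0 mulr1 subrr add0r.
  apply: eq_bigr => i _; rewrite !cauchy_term_scale.
  rewrite -[X in X - _]mulr1 -mulrBr cauchy_termS; ring.
have L : ((fun n => series (cauchy_term x y) n.+1 -
     series (cauchy_term (x * q) (y * q)) n.+1) : nat -> R[i]^o) @ \oo -->
    (cauchy_sum x y - cauchy_sum (x * q) (y * q) : R[i]^o).
  have F' := F; rewrite -cvg_shiftS in F'.
  have G' := G; rewrite -cvg_shiftS in G'.
  exact: (@cvgB _ R[i]^o _ _ _ _ _ _ _ F' G').
have M : ((fun n => series (cauchy_term x y) n.+1 -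
     series (cauchy_term (x * q) (y * q)) n.+1) : nat -> R[i]^o) @ \oo -->
    (x * cauchy_sum x y - y * cauchy_sum (x * q) (y * q) : R[i]^o).
  under eq_fun do rewrite H.
  apply: (@cvgB _ R[i]^o); apply: (@cvgM R[i]).
  - exact: cvg_cst.
  - exact: F.
  - exact: cvg_cst.
  - exact: G.
have E : cauchy_sum x y - cauchy_sum (x * q) (y * q) =
    x * cauchy_sum x y - y * cauchy_sum (x * q) (y * q).
  exact: (@norm_cvg_unique R[i] R[i]^o _ _ _ _ L M).
set F1 := cauchy_sum x y in E *; set G1 := cauchy_sum _ _ in E *.
have -> : (1 - x) * F1 = (F1 - G1) + G1 - x * F1 by ring.
by rewrite E; ring.
Qed.

Lemma cauchy_sum_qpoch x y N : `|x| < 1 ->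
  qpoch x q N * cauchy_sum x y =
  qpoch y q N * cauchy_sum (x * q ^+ N) (y * q ^+ N).
Proof.
move=> x1; elim: N => [|N IH]; first by rewrite !qpoch0 !mulr1.
rewrite !qpochS mulrAC IH mulrAC -[LHS]mulrA cauchy_sum_qshift ?norm_mul_expq//.
by rewrite -!mulrA -exprSr !mulrA.
Qed.

(** The k-th term gets the factor q^(Nk) and the term at 0 stays 1, so the distance to 1 is at most
    [S * normc q ^+ N], where [S] is the sum of the moduli. *)
Lemma cvg_cauchy_sum1 x y : `|x| < 1 ->
  ((fun N => cauchy_sum (x * q ^+ N) (y * q ^+ N)) : nat -> R[i]^o) @ \oo -->
  (1 : R[i]^o).
Proof.
move=> x1; apply/cvgc_normP.
have cs := cauchy_term_summable _ y x1.
set S := limn (series (fun n => normc (cauchy_term x y n))).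
have Sn n : series (fun n => normc (cauchy_term x y n)) n <= S.
  apply: nondecreasing_cvgn_le => //.
  apply/nondecreasing_seqP => k; rewrite /series/= big_nat_recr//= lerDl.
  exact: normc_ge0.
have nq1 : `|normc q| < 1.
  by rewrite ger0_norm ?normc_ge0// -ltcR -normcE_norm.
have normcX n : normc (q ^+ n) = normc q ^+ n.
  by elim: n => [|n IH]; rewrite ?normc1// !exprS normcM IH.
apply: (@squeeze_cvgr _ _ _ _ (fun=> 0) (geometric S (normc q))); last 2 first.
- exact: cvg_cst.
- exact: cvg_geometric.
near=> N; rewrite normc_ge0/=.
set F := cauchy_sum _ _.
have /cvgc_normP FN := cvg_cauchy_sum _ (y * q ^+ N) (norm_mul_expq _ N x1).
(* Adding the vanishing distance from the partial sums to [F] lets the estimate, proved for partial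
   sums, pass to the limit. *)
have FN' : (fun n => normc (series (cauchy_term (x * q ^+ N) (y * q ^+ N)) n - F)
    + S * normc q ^+ N) @ \oo --> 0 + S * normc q ^+ N.
  by apply: cvgD => //; exact: cvg_cst.
rewrite add0r in FN'.
rewrite -(cvg_lim _ FN')//; apply: limr_ge; first exact: cvgP FN'.
(* Only a nonempty partial sum contains the leading 1 that is subtracted. *)
exists 1%N => // n /= n0.
case: n n0 => // n _.
set s := series _ n.+1.
apply: (@le_trans _ _ (normc (s - F) + normc (s - 1))).
  rewrite -(normcN (s - F)); apply: le_trans (le_normcD _ _).
  by rewrite opprB addrA subrK.
rewrite lerD2l.
have -> : s - 1 = \sum_(k < n) cauchy_term x y k.+1 * q ^+ N ^+ k.+1.
  rewrite /s /series/= big_mkord big_ord_recl.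
  rewrite {1}/cauchy_term cauchy_poly0 qpoch0 divr1 addrAC subrr add0r.
  by apply: eq_bigr => k _; rewrite cauchy_term_scale.
apply: (@le_trans _ _ (\sum_(k < n) normc (cauchy_term x y k.+1) * normc q ^+ N)).
  rewrite -lecR -normcE_norm rmorph_sum/=; apply: le_trans (ler_norm_sum _ _ _) _.
  apply: ler_sum => k _; rewrite normcE_norm lecR normcM ler_wpM2l ?normc_ge0//.
  rewrite -exprM normcX mulnS exprD ler_piMr ?exprn_ge0 ?normc_ge0//.
  by rewrite exprn_ile1 ?normc_ge0// ltW// -ltcR -normcE_norm.
rewrite -mulr_suml ler_wpM2r ?exprn_ge0 ?normc_ge0//.
apply: le_trans (Sn n.+1).
by rewrite /series/= big_mkord big_ord_recl lerDr normc_ge0.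
Unshelve. all: by end_near. Qed.

Lemma cvg_qpoch_inf y :
  (qpoch y q : nat -> R[i]^o) @ \oo --> (qpoch_inf y q : R[i]^o).
Proof.
have x0 : `|0 : R[i]| < 1 by rewrite normr0.
have F1 := cvg_cauchy_sum1 _ y x0.
(* As [qpoch_inf] is itself a [limn], convergence to any value suffices. *)
suff : (qpoch y q : nat -> R[i]^o) @ \oo --> (cauchy_sum 0 y * 1^-1 : R[i]^o).
  by move=> /cvgP.
apply: (@cvg_trans _ ((fun N => cauchy_sum 0 y *
    (cauchy_sum (0 * q ^+ N) (y * q ^+ N))^-1 : R[i]^o) @ \oo)); last first.
  apply: (@cvgM R[i]); first exact: cvg_cst.
  by apply: (@cvgV R[i]); [exact: oner_neq0|exact: F1].
apply: near_eq_cvg.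
(* Once within distance 1 of 1 the shifted sum is nonzero, so it can be divided out. *)
have /cvgrPdist_lt/(_ 1 ltr01) := F1.
apply: filterS => N h.
have F0 : cauchy_sum (0 * q ^+ N) (y * q ^+ N) != 0.
  by apply: contraTneq h => ->; rewrite subr0 normr1 ltxx.
by have := cauchy_sum_qpoch _ y N x0; rewrite qpoch0l mul1r => ->; rewrite mulfK.
Qed.

Lemma qpoch_inf_cauchy_sum x y : `|x| < 1 ->
  qpoch_inf x q * cauchy_sum x y = qpoch_inf y q.
Proof.
move=> x1.
pose u : nat -> R[i]^o := fun N => qpoch x q N * cauchy_sum x y.
apply: (@norm_cvg_unique R[i] R[i]^o (u @ \oo)).
  by apply: (@cvgM R[i]); [exact: cvg_qpoch_inf|exact: cvg_cst].
have -> : u = (fun N => qpoch y q N * cauchy_sum (x * q ^+ N) (y * q ^+ N)).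
  by apply/funext => N; exact: cauchy_sum_qpoch.
rewrite /= -[qpoch_inf y q]mulr1.
by apply: (@cvgM R[i]); [exact: cvg_qpoch_inf|exact: cvg_cauchy_sum1].
Qed.

Lemma qpoch_inf0 : qpoch_inf 0 q = 1 :> R[i].
Proof.
apply: (@norm_cvg_unique R[i] R[i]^o ((qpoch 0 q : nat -> R[i]^o) @ \oo)).
  exact: cvg_qpoch_inf.
have -> : (qpoch 0 q : nat -> R[i]^o) = (fun=> 1).
  by apply/funext => N; exact: qpoch0l.
exact: cvg_cst.
Qed.

Lemma q_binomial_theorem x y : `|x| < 1 ->
  cauchy_sum x y = qpoch_inf y q / qpoch_inf x q.
Proof.
move=> x1; rewrite -(qpoch_inf_cauchy_sum _ y x1) mulrC mulKf//.
have := qpoch_inf_cauchy_sum _ 0 x1; rewrite qpoch_inf0.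
by apply: contra_eqN => /eqP->; rewrite mul0r eq_sym oner_neq0.
Qed.

End QBinomialTheorem.

(** * Complex powers for a fixed logarithm *)

Section ComplexPowerTheory.
Context {R : realType}.
Implicit Types (lam b : R[i]).

Lemma cexp0 : cexp 0 = 1 :> R[i].
Proof. by rewrite /cexp /= expR0 cos0 sin0 mulr1 mulr0. Qed.

Lemma cexpD (z w : R[i]) : cexp (z + w) = cexp z * cexp w.
Proof.
case: z w => [a b] [c d]; rewrite /cexp /= expRD cosD sinD.
by apply/eqP; rewrite eq_complex /=; apply/andP; split; apply/eqP; ring.
Qed.

Lemma cpow0 lam : cpow lam 0 = 1.
Proof. by rewrite /cpow mul0r cexp0. Qed.

Lemma cpowD lam b c : cpow lam (b + c) = cpow lam b * cpow lam c.
Proof. by rewrite /cpow mulrDl cexpD. Qed.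

Lemma cpow_neq0 lam b : cpow lam b != 0.
Proof.
have : cpow lam b * cpow lam (- b) = 1 by rewrite -cpowD subrr cpow0.
by apply: contra_eqN => /eqP->; rewrite mul0r eq_sym oner_neq0.
Qed.

Lemma cpowN lam b : cpow lam (- b) = (cpow lam b)^-1.
Proof.
by apply: (mulfI (cpow_neq0 lam b)); rewrite -cpowD subrr cpow0 divff ?cpow_neq0.
Qed.

Lemma cpowMn lam b n : cpow lam (b * n%:R) = cpow lam b ^+ n.
Proof.
elim: n => [|n IH]; first by rewrite mulr0 cpow0.
by rewrite -natr1 mulrDr mulr1 cpowD IH exprSr.
Qed.

(** On integer exponents the power does not depend on the chosen determination of the logarithm. *)
Lemma cpow_int lam (i : int) : cpow lam i%:~R = cexp lam ^ i.
Proof.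
have H n : cpow lam n%:R = cexp lam ^+ n.
  by rewrite -[n%:R]mul1r cpowMn /cpow mul1r.
case: i => n; first exact: H.
by rewrite NegzE mulrNz cpowN -exprnN; congr (_^-1); exact: H.
Qed.

Lemma cpow_nat lam n : cpow lam n%:R = cexp lam ^+ n.
Proof. exact: (cpow_int lam n). Qed.

End ComplexPowerTheory.

(** * Finite identities for q-shifted factorials and Cauchy polynomials *)

Lemma qpoch_sq (K : fieldType) (q : K) n :
  qpoch (q ^+ 2) (q ^+ 2) n = qpoch q q n * qpoch (- q) q n.
Proof.
elim: n => [|n IH]; first by rewrite !qpoch0 mulr1.
by rewrite !qpochS IH -exprM mulnC exprM; ring.
Qed.

(** Reversal of factors, 1 - q^(j-n) = -q^(j-n) (1 - q^(n-j)), multiplied over j < k with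
    denominators cleared. *)
Lemma qpoch_inv_expr (K : fieldType) (q : K) n k : q != 0 -> (k <= n)%N ->
  qpoch (q ^+ n)^-1 q k * qpoch q q (n - k) * (-1) ^+ k * q ^+ (n * k) =
  q ^+ 'C(k, 2) * qpoch q q n.
Proof.
move=> q0; elim: k => [|k IH] kn.
  by rewrite qpoch0 subn0 muln0 bin0n !expr0 !mulr1 mul1r.
have := IH (ltnW kn).
set m := (n - k.+1)%N; have -> : (n - k = m.+1)%N by rewrite /m; lia.
rewrite !qpochS binS bin1 exprD mulnS exprD exprS => IH'.
rewrite [RHS]mulrAC -IH'.
have -> : q ^+ n = q ^+ k * (q * q ^+ m).
  by rewrite -exprS -exprD; congr (q ^+ _); rewrite /m; lia.
have q0k j : q ^+ j != 0 by rewrite expf_neq0.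
by field; rewrite q0 !q0k.
Qed.

(** The last k factors of p_n(x, y) are reversed: y - q^j x q^(1-n) = -q^(j+1-n) (x - q^(n-1-j) y)
    for j < k. *)
Lemma cauchy_poly_split (K : fieldType) (q x y : K) (n k : nat) :
  q != 0 -> (k <= n)%N ->
  q ^+ 'C(k, 2) * cauchy_poly q (n - k) x y
    * cauchy_poly q k y (x * q ^ (1 - n%:Z)) =
  cauchy_poly q n x y * ((-1) ^+ k * q ^ (k%:Z * (k%:Z - n%:Z))).
Proof.
move=> q0; elim: k => [|k IH] kn.
  by rewrite cauchy_poly0 subn0 bin0n !expr0 mul0r expr0z !mulr1 mul1r.
have := IH (ltnW kn).
set m := (n - k.+1)%N; have -> : (n - k = m.+1)%N by rewrite /m; lia.
rewrite !cauchy_polyS binS bin1 exprD exprS.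
have -> : q ^ (k.+1%:Z * (k.+1%:Z - n%:Z)) =
    q ^ (k%:Z * (k%:Z - n%:Z)) * (q ^+ k / q ^+ m).
  rewrite exprnN -[q ^+ k]/(q ^ k%:Z) -!expfzDr//; congr (q ^ _).
  rewrite /m; lia.
set Pk := cauchy_poly q k _ _ => IH'.
have -> : q ^+ k * (x * q ^ (1 - n%:Z)) = x / q ^+ m.
  rewrite mulrCA exprnN -[q ^+ k]/(q ^ k%:Z) -expfzDr//; congr (_ * q ^ _).
  rewrite /m; lia.
rewrite mulN1r mulNr mulrN !mulrA -(mulrA _ ((-1) ^+ k)) -IH'.
by field; rewrite expf_neq0.
Qed.

(** * The generating function of the generalized q-polynomials *)

Section GeneratingFunction.
Context {R : realType}.
Variables q lam : R[i].
Hypotheses (q_neq0 : q != 0) (q_lt1 : `|q| < 1) (lam_log : cexp lam = q).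
Implicit Types (alpha x y z t a w : R[i]) (r s : int).

Let Nq_lt1 : `|- q| < 1. Proof. by rewrite normrN. Qed.

Lemma qbinom_nat n k : (k <= n)%N ->
  qbinom q lam n%:R k = qpoch q q n / (qpoch q q k * qpoch q q (n - k)).
Proof.
move=> kn; have := @qpoch_inv_expr _ q n k q_neq0 kn.
rewrite /qbinom cpowN cpowD cpowN cpowMn !cpow_nat lam_log -exprM.
set u := qpoch _ q k; set v := qpoch q q n => E.
have -> : v = u * qpoch q q (n - k) * (-1) ^+ k * q ^+ (n * k) / q ^+ 'C(k, 2).
  by rewrite E mulrC mulKf// expf_neq0.
by field; rewrite !qpoch_neq0// expf_neq0.
Qed.

(** The term of the right-hand series, [w] standing for [z * t]. *)
Definition gf_term r s alpha a w (k : nat) : R[i] :=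
  qpoch (- cpow lam (- alpha)) q k * qpoch a q k / qpoch (q ^+ 2) (q ^+ 2) k
  * cpow lam (k%:R * alpha + (r * 'C(k, 2)%:Z - s * 'C(k.+1, 2)%:Z)%:~R)
  * w ^+ k.

(** The factor (q; q)_n of the binomial cancels, q^C(k,2) cancels the opposite power in
    [qbinom_neg], and (q; q)_k (-q; q)_k merges into (q^2; q^2)_k. *)
Lemma Ltilde_conv r s n alpha x y z t a :
  Ltilde q lam r s n alpha x y z a * (t ^+ n / qpoch q q n) =
  \sum_(k < n.+1) gf_term r s alpha a (z * t) k
                  * cauchy_term q (x * t) (y * t) (n - k).
Proof.
rewrite /Ltilde mulr_suml; apply: eq_bigr => -[k /= kn] _; rewrite ltnS in kn.
rewrite qbinom_nat// /qbinom_neg /gf_term /cauchy_term cauchy_poly_scale qpoch_sq.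
rewrite !cpowD cpowN cpowN cpow_int cpow_nat lam_log (mulrC k%:R) cpowMn.
rewrite expfzDr// -[q ^ 'C(k, 2)%:Z]/(q ^+ 'C(k, 2)) exprMn.
have -> : t ^+ n = t ^+ k * t ^+ (n - k) by rewrite -exprD subnKC.
by field; rewrite !qpoch_neq0// !expf_neq0.
Qed.

(** The exponent of q grows by r k - s (k + 1), which gives the factor (q^(r-s))^k / q^s. *)
Lemma gf_termS r s alpha a w k :
  gf_term r s alpha a w k.+1 = gf_term r s alpha a w k *
   ((1 - - cpow lam (- alpha) * q ^+ k) * (1 - a * q ^+ k)
    / (1 - q ^+ 2 * (q ^+ 2) ^+ k)
    * (cpow lam alpha * w / q ^ s * (q ^ (r - s)) ^+ k)).
Proof.
have q2 : `|q ^+ 2| < 1 by rewrite normrX exprn_ilt1.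
rewrite /gf_term !qpochS !(mulrC _.+1%:R) !(mulrC k%:R) !cpowD !cpowMn !cpow_int.
rewrite lam_log [w ^+ k.+1]exprS [cpow lam alpha ^+ k.+1]exprS.
have -> : q ^ (r * 'C(k.+1, 2)%:Z - s * 'C(k.+2, 2)%:Z) =
    q ^ (r * 'C(k, 2)%:Z - s * 'C(k.+1, 2)%:Z) * ((q ^ (r - s)) ^+ k / q ^ s).
  have -> : (q ^ (r - s)) ^+ k = q ^ ((r - s) * k%:Z) by rewrite -exprz_exp.
  rewrite invr_expz -!expfzDr//; congr (q ^ _).
  rewrite (binS k.+1 1) (binS k 1) !bin1 !PoszD; ring.
have D0 : 1 - q ^+ 2 * (q ^+ 2) ^+ k != 0.
  by apply: one_sub_neq0; exact: (norm_mul_expq _ q2 _ _ q2).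
by field; rewrite D0 qpoch_neq0// expfz_neq0.
Qed.

(** The q-factorial part of the ratio tends to 1, so the remaining factor alone decides: its limit
    is 0 when [s < r] and [w * cpow lam alpha] when both exponents vanish. *)
Lemma gf_term_summable r s alpha a w l :
  ((fun k => cpow lam alpha * w / q ^ s * (q ^ (r - s)) ^+ k) : nat -> R[i]^o)
     @ \oo --> (l : R[i]^o) ->
  `|l| < 1 -> abs_summable (gf_term r s alpha a w).
Proof.
move=> hl l1.
have q2 : `|q ^+ 2| < 1 by rewrite normrX exprn_ilt1.
apply: (@ratio_test _ _ _ (1 * 1 / 1 * l) (gf_termS r s alpha a w)).
  apply: (@cvgM R[i]); last exact: hl.
  apply: (@cvgM R[i]).
    by apply: (@cvgM R[i]); exact: cvg_one_sub_cmul_expc.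
  by apply: (@cvgV R[i]); [exact: oner_neq0|exact: cvg_one_sub_cmul_expc].
by rewrite divr1 !mul1r.
Qed.

Lemma gf_term_summable_lt r s alpha a w :
  s < r -> abs_summable (gf_term r s alpha a w).
Proof.
move=> sr; apply: (@gf_term_summable _ _ _ _ _ 0); last by rewrite normr0.
apply: cvg_cmul_expc.
have -> : r - s = `|r - s|%N%:Z by rewrite gez0_abs// subr_ge0 ltW.
rewrite normrX exprn_ilt1//.
by rewrite absz_eq0 subr_eq0 gt_eqF.
Qed.

Lemma gf_term00 alpha a w k :
  gf_term 0 0 alpha a w k =
  phi21_term (- cpow lam (- alpha)) a (- q) q (w * cpow lam alpha) k.
Proof.
rewrite /gf_term /phi21_term !mul0r subr0 addr0 (mulrC k%:R) cpowMn qpoch_sq.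
by rewrite exprMn; field; rewrite !qpoch_neq0.
Qed.

Lemma gf_term00_summable alpha a w :
  `|w * cpow lam alpha| < 1 -> abs_summable (gf_term 0 0 alpha a w).
Proof.
apply: gf_term_summable.
have -> : (fun k => cpow lam alpha * w / q ^ (0 : int) * (q ^ (0 - 0 : int)) ^+ k)
    = (fun=> w * cpow lam alpha).
  by apply/funext => k; rewrite subr0 expr0z expr1n mulr1 divr1 mulrC.
exact: cvg_cst.
Qed.

Lemma generating_function r s alpha x y z t a :
  `|x * t| < 1 -> cvgn (series (gf_term r s alpha a (z * t) : nat -> R[i]^o)) ->
  series ((fun n => Ltilde q lam r s n alpha x y z a * (t ^+ n / qpoch q q n))
     : nat -> R[i]^o) @ \oo -->
  (qpoch_inf (y * t) q / qpoch_inf (x * t) q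
   * limn (series (gf_term r s alpha a (z * t) : nat -> R[i]^o)) : R[i]^o).
Proof.
move=> xt gfc.
have -> : (fun n => Ltilde q lam r s n alpha x y z a * (t ^+ n / qpoch q q n)) =
    (fun n => \sum_(k < n.+1) gf_term r s alpha a (z * t) k
                  * cauchy_term q (x * t) (y * t) (n - k)).
  by apply/funext => n; exact: Ltilde_conv.
rewrite -(@q_binomial_theorem R q q_lt1 (x * t) (y * t) xt).
apply: mertens; last exact: gfc.
exact: cauchy_term_summable.
Qed.

Lemma Ltilde00 n alpha x y z a :
  (forall k : nat, (k <= n)%N -> cauchy_poly q k y (x * q ^ (1 - n%:Z)) != 0) ->
  Ltilde q lam 0 0 n alpha x y z a = cauchy_poly q n x y *
    \sum_(k < n.+1)
      qbinom q lam n%:R k * qbinom_neg q lam alpha k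
      * ((-1) ^+ k * q ^ (k%:Z * (k%:Z - n%:Z)) * qpoch a q k
         / cauchy_poly q k y (x * q ^ (1 - n%:Z)))
      * z ^+ k.
Proof.
move=> p0; rewrite /Ltilde mulr_sumr; apply: eq_bigr => -[k /= kn] _.
have := @cauchy_poly_split _ q x y n k q_neq0 kn.
have := p0 _ kn; rewrite !mul0r subr0 add0r -[q ^ 'C(k, 2)%:Z]/(q ^+ 'C(k, 2)).
set P := cauchy_poly q k y _; set T := q ^ _.
set p := cauchy_poly _ _ _ _; set p' := cauchy_poly _ _ _ _ => P0 E.
(* Inserting [P / P] produces the left-hand side of [cauchy_poly_split]. *)
have -> : q ^+ 'C(k, 2) = q ^+ 'C(k, 2) * P / P by rewrite mulfK.
transitivity (qbinom q lam n%:R k * qbinom_neg q lam alpha k * qpoch a q k *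
  z ^+ k / P * (q ^+ 'C(k, 2) * p * P)); first by ring.
by rewrite E; ring.
Qed.

End GeneratingFunction.

(** Sums are stated as limits of partial sums, since [limn] has a default value on divergent
    sequences. For [s < r] the right-hand series always converges; otherwise its convergence depends
    on the parameters and is assumed. In the second part [w] is the argument of the 2Phi1 series,
    and the nonvanishing condition gives meaning to the quotients. *)
Theorem theorem6 (R : realType) (q lam alpha x y z t a : R[i])
    (hq0 : q != 0) (hq1 : `|q| < 1) (hlam : cexp lam = q) :
  (* (i) *)
  (forall r s : int, r != 0 -> s != 0 -> `|x * t| < 1 ->
     let rhs : nat -> R[i]^o := fun k =>
       qpoch (- cpow lam (- alpha)) q k * qpoch a q k / qpoch (q ^+ 2) (q ^+ 2) k
       * cpow lam (k%:R * alpha + (r * 'C(k, 2)%:Z - s * 'C(k.+1, 2)%:Z)%:~R)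
       * (z * t) ^+ k in
     let lhs : nat -> R[i]^o := fun n =>
       Ltilde q lam r s n alpha x y z a * (t ^+ n / qpoch q q n) in
     s < r \/ cvgn (series rhs) ->
     cvgn (series rhs) /\
     series lhs @ \oo -->
       (qpoch_inf (y * t) q / qpoch_inf (x * t) q * limn (series rhs) : R[i]^o))
  /\
  (* (ii) *)
  (`|z * t| < 1 -> `|x * t| < 1 ->
     (forall n k : nat, (k <= n)%N ->
        cauchy_poly q k y (x * q ^ (1 - n%:Z)) != 0) ->
     let w : R[i] := z * t * cpow lam alpha in
     let rhs : nat -> R[i]^o :=
       phi21_term (- cpow lam (- alpha)) a (- q) q w in
     let inner : nat -> R[i] := fun n =>
       \sum_(k < n.+1)
          qbinom q lam n%:R k * qbinom_neg q lam alpha k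
          * ((-1) ^+ k * q ^ (k%:Z * (k%:Z - n%:Z)) * qpoch a q k
             / cauchy_poly q k y (x * q ^ (1 - n%:Z)))
          * z ^+ k in
     let lhs : nat -> R[i]^o := fun n =>
       cauchy_poly q n x y * t ^+ n / qpoch q q n * inner n in
     (forall n : nat,
        Ltilde q lam 0 0 n alpha x y z a = cauchy_poly q n x y * inner n)
     /\
     (`|w| < 1 \/ cvgn (series rhs) ->
      cvgn (series rhs) /\
      series lhs @ \oo -->
        (qpoch_inf (y * t) q / qpoch_inf (x * t) q
         * phi21 (- cpow lam (- alpha)) a (- q) q w : R[i]^o))).
Proof.
split=> [r s _ _ xt rhs lhs hrhs|_ xt p_neq0 w rhs inner lhs].
  have cvg_rhs : cvgn (series rhs).
    case: hrhs => [sr|//]; apply: abs_summable_cvg.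
    exact: (gf_term_summable_lt _ _ hq0 hq1 hlam).
  split; first exact: cvg_rhs.
  exact: (generating_function _ _ hq0 hq1 hlam).
have LE n : Ltilde q lam 0 0 n alpha x y z a = cauchy_poly q n x y * inner n.
  by apply: Ltilde00 => // k; exact: p_neq0.
split=> // hrhs.
have rhsE : rhs = gf_term q lam 0 0 alpha a (z * t).
  by apply/funext => k; rewrite gf_term00.
have lhsE : lhs =
    (fun n => Ltilde q lam 0 0 n alpha x y z a * (t ^+ n / qpoch q q n)).
  by apply/funext => n; rewrite LE /lhs -!mulrA; congr (_ * _); rewrite mulrA mulrC.
have cvg_rhs : cvgn (series rhs).
  case: hrhs => [w1|//]; rewrite rhsE; apply: abs_summable_cvg.
  exact: (gf_term00_summable _ _ hq0 hq1 hlam).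
split; first exact: cvg_rhs.
rewrite /phi21 -/rhs lhsE; rewrite rhsE in cvg_rhs *.
exact: (generating_function _ _ hq0 hq1 hlam).
Qed.
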